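(* Let $X$ be a compact metrizable space with $|X|\ge 2$. Let $\mathcal{PM}$ be the space of all continuous pseudometrics defined on nonempty compact subsets of $X$, topologized by identifying pseudometrics with their graphs in the hyperspace of $X\times X\times\mathbb{R}$, and let $\mathcal{PM}(X)\subset\mathcal{PM}$ be the subspace of continuous pseudometrics on all of $X$. Then there exists a continuous regular linear extension operator $u\colon\mathcal{PM}\to\mathcal{PM}(X)$.
   Context: For a space $Y$, $\exp Y$ denotes the set of all nonempty compact subsets of $Y$ with the Vietoris topology, whose base consists of the sets $\langle U_1,\dots,U_k\rangle=\{A\in\exp Y\mid A\subset\bigcup_{i=1}^k U_i,\ A\cap U_i\ne\emptyset\text{ for all }i\}$ with $U_1,\dots,U_k$ open in $Y$ (for a compatible metric $d$ on $Y$ it is generated by the Hausdorff metric $d_H$). For $A\in\exp X$, $\mathcal{PM}(A)$ is the set of continuous pseudometrics on $A$; $\mathcal{PM}=\bigcup\{\mathcal{PM}(A)\mid A\in\exp X\}$; if $\varrho\in\mathcal{PM}(A)$ we write $\operatorname{dom}\varrho=A$. Each $\varrho\in\mathcal{PM}$ is identified with its graph, a compact subset of $X\times X\times\mathbb{R}$, and $\mathcal{PM}$ carries the subspace topology from $\exp(X\times X\times\mathbb{R})$. A map $u\colon\mathcal{PM}\to\mathcal{PM}(X)$ is: - linear if $u(c\varrho)=c\,u(\varrho)$ for all $c\in\mathbb{R}_+=[0,\infty)$, $\varrho\in\mathcal{PM}$, and $u(\varrho+\lambda)=u(\varrho)+u(\lambda)$ for all $\varrho,\lambda\in\mathcal{PM}$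 with $\operatorname{dom}\varrho=\operatorname{dom}\lambda$; - regular if $\|u(\varrho)\|=\|\varrho\|$ for every $\varrho\in\mathcal{PM}$, where $\|\varrho\|=\sup\{\varrho(x,y)\mid x,y\in\operatorname{dom}\varrho\}$; - an extension operator if $u(\varrho)|(\operatorname{dom}\varrho\times\operatorname{dom}\varrho)=\varrho$ for every $\varrho\in\mathcal{PM}$. *)

(* Defs.v *)
From HB Require Import structures.
From mathcomp Require Import all_boot all_order all_algebra.
From mathcomp Require Import all_classical all_reals topology normedtype.

Set Implicit Arguments.
Unset Strict Implicit.
Unset Printing Implicit Defensive.

Import Order.TTheory GRing.Theory Num.Theory.
Import numFieldNormedType.Exports.

Local Open Scope classical_set_scope.
Local Open Scope ring_scope.

Definition is_metric (R : realType) (X : Type) (d : X -> X -> R) : Prop :=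
  [/\ forall x y, 0 <= d x y,
      forall x y, d x y = 0 <-> x = y,
      forall x y, d x y = d y x &
      forall x y z, d x z <= d x y + d y z].

Definition metrizable (R : realType) (X : topologicalType) : Prop :=
  exists2 d : X -> X -> R, is_metric d &
    forall (x : X) (A : set X),
      nbhs x A <-> exists2 e : R, 0 < e & [set y | d x y < e] `<=` A.

Record hyperspace (Y : topologicalType) := Hyperspace {
  hset :> set Y;
  hset_compact : compact hset;
  hset_nonempty : hset !=set0 }.

HB.instance Definition _ (Y : topologicalType) := gen_eqMixin (hyperspace Y).
HB.instance Definition _ (Y : topologicalType) :=
  gen_choiceMixin (hyperspace Y).

Section vietoris.
Variable Y : topologicalType.

Definition vietoris_base (Us : seq (set Y)) : set (hyperspace Y) :=
  [set A : hyperspace Y |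
    (A : set Y) `<=` \bigcup_(U in [set` Us]) U /\
    forall U, U \in Us -> (A : set Y) `&` U !=set0].

Definition vietoris_dom : set (seq (set Y)) :=
  [set Us | forall U, U \in Us -> open U].

HB.instance Definition _ := isPointed.Build (seq (set Y)) [::].

Let vietoris_cover : \bigcup_(Us in vietoris_dom) vietoris_base Us = setT.
Proof.
apply/seteqP; split => // A _; exists [:: setT].
  by move=> U; rewrite inE => /eqP ->; exact: openT.
split; first by move=> y _; exists setT => //=; rewrite inE.
move=> U; rewrite inE => /eqP ->; rewrite setIT; exact: hset_nonempty.
Qed.

Let vietoris_join (Us Vs : seq (set Y)) (A : hyperspace Y) :
  vietoris_dom Us -> vietoris_dom Vs ->
  vietoris_base Us A -> vietoris_base Vs A ->
  exists Ws, [/\ vietoris_dom Ws, vietoris_base Ws A &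
    vietoris_base Ws `<=` vietoris_base Us `&` vietoris_base Vs].
Proof.
move=> oU oV [AU AmU] [AV AmV].
pose bU := \bigcup_(U in [set` Us]) U; pose bV := \bigcup_(V in [set` Vs]) V.
have obU : open bU by apply: bigcup_open => U /= /oU.
have obV : open bV by apply: bigcup_open => V /= /oV.
exists ([seq U `&` bV | U <- Us] ++ [seq V `&` bU | V <- Vs]); split.
- move=> W; rewrite mem_cat => /orP[] /mapP[Z ZU ->]; apply: openI => //.
    exact: oU.
  exact: oV.
- split.
    move=> y Ay; have [U UUs Uy] := AU y Ay.
    exists (U `&` bV); last by split => //; exact: AV.
    by rewrite /= mem_cat (map_f (fun U => U `&` bV)).
  move=> W; rewrite mem_cat => /orP[] /mapP[Z ZU ->].
    by have [y [Ay Zy]] := AmU Z ZU; exists y; split=> //; split=> //; exact: AV.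
  by have [y [Ay Zy]] := AmV Z ZU; exists y; split=> //; split=> //; exact: AU.
- move=> B [BW BmW].
  have BUV y : (B : set Y) y -> bU y /\ bV y.
    move=> /BW[W] /=; rewrite mem_cat => /orP[] /mapP[Z ZU ->] [Zy bW].
      by split => //; exists Z.
    by split => //; exists Z.
  split; split.
  + by move=> y /BUV[].
  + move=> U UUs; have [|y [By [Uy _]]] := BmW (U `&` bV).
      by rewrite mem_cat (map_f (fun U => U `&` bV)).
    by exists y.
  + by move=> y /BUV[].
  + move=> V VVs; have [|y [By [Vy _]]] := BmW (V `&` bU).
      by rewrite mem_cat orbC (map_f (fun V => V `&` bU)).
    by exists y.
Qed.

HB.instance Definition _ :=
  isBaseTopological.Build (hyperspace Y) vietoris_cover vietoris_join.

End vietoris.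

(* A pseudometric on [pm_dom] is encoded by a total function vanishing off
   [pm_dom `*` pm_dom], so that Leibniz equality on [PM] is equality of
   partially defined pseudometrics (see [pm_ext] and [pm_graph_inj]). *)
Record PM (R : realType) (X : topologicalType) := MkPM {
  pm_dom : set X;
  pm_fun :> X -> X -> R;
  pm_dom_compact : compact pm_dom;
  pm_dom_nonempty : pm_dom !=set0;
  pm_off : forall x y, ~ (pm_dom `*` pm_dom) (x, y) -> pm_fun x y = 0;
  pm_ge0 : forall x y, pm_dom x -> pm_dom y -> 0 <= pm_fun x y;
  pm_refl : forall x, pm_dom x -> pm_fun x x = 0;
  pm_sym : forall x y, pm_dom x -> pm_dom y -> pm_fun x y = pm_fun y x;
  pm_triangle : forall x y z, pm_dom x -> pm_dom y -> pm_dom z ->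
    pm_fun x z <= pm_fun x y + pm_fun y z;
  pm_cont : {within pm_dom `*` pm_dom,
    continuous (fun p : X * X => pm_fun p.1 p.2)} }.

HB.instance Definition _ (R : realType) (X : topologicalType) :=
  gen_eqMixin (PM R X).
HB.instance Definition _ (R : realType) (X : topologicalType) :=
  gen_choiceMixin (PM R X).

Section PM_theory.
Variables (R : realType) (X : topologicalType).
Implicit Types rho lam : PM R X.

Lemma pm_ext rho lam : pm_dom rho = pm_dom lam ->
  (forall x y, pm_dom rho x -> pm_dom rho y -> rho x y = lam x y) -> rho = lam.
Proof.
case: rho => A f Ac An fo f0 fr fs ft fc.
case: lam => B g Bc Bn go g0 gr gs gt gc /= AB fg; subst B.
have fgE : f = g.
  apply/funext => x; apply/funext => y.
  have [[Ax Ay]|nA] := pselect ((A `*` A) (x, y)); first exact: fg.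
  by rewrite fo // go.
by subst g; f_equal; exact: Prop_irrelevance.
Qed.

Definition pm_graph_set rho : set (X * X * R) :=
  [set (p, rho p.1 p.2) | p in pm_dom rho `*` pm_dom rho].

Lemma pm_graph_compact rho : compact (pm_graph_set rho).
Proof.
apply: continuous_compact; last by apply: compact_setX; exact: pm_dom_compact.
have idc : {within pm_dom rho `*` pm_dom rho, continuous (@id (X * X))}.
  by apply: continuous_subspaceT => x; exact: cvg_id.
by move=> p; exact: (cvg_pair (idc p) (@pm_cont _ _ rho p)).
Qed.

Lemma pm_graph_nonempty rho : pm_graph_set rho !=set0.
Proof.
have [x Ax] := pm_dom_nonempty rho.
by exists (x, x, rho x x); exists (x, x).
Qed.

Definition pm_graph rho : hyperspace (X * X * R)%type :=
  Hyperspace (@pm_graph_compact rho) (pm_graph_nonempty rho).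

Lemma pm_graph_inj : injective pm_graph.
Proof.
move=> rho lam /(congr1 (@hset _)) /= E.
have sub (r s : PM R X) : pm_graph_set r = pm_graph_set s ->
    forall x y, pm_dom r x -> pm_dom r y ->
      [/\ pm_dom s x, pm_dom s y & s x y = r x y].
  move=> rs x y rx ry.
  have : pm_graph_set r (x, y, r x y) by exists (x, y).
  by rewrite rs => -[[a b] [/= sa sb] [<- <- <-]].
apply: pm_ext => [|x y Ax Ay]; last by have [] := sub _ _ E x y Ax Ay.
apply/seteqP; split => x Ax; first by have [] := sub _ _ E x x Ax Ax.
by have [] := sub _ _ (esym E) x x Ax Ax.
Qed.

HB.instance Definition _ := Topological.copy (PM R X) (initial_topology pm_graph).

Program Definition pm_scale (c : R) (c0 : 0 <= c) rho : PM R X :=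
  @MkPM R X (pm_dom rho) (fun x y => c * rho x y) (@pm_dom_compact _ _ rho)
    (pm_dom_nonempty rho) _ _ _ _ _ _.
Next Obligation. by move=> c c0 rho x y nA /=; rewrite pm_off ?mulr0. Qed.
Next Obligation. by move=> c c0 rho x y Ax Ay; rewrite mulr_ge0 ?pm_ge0. Qed.
Next Obligation. by move=> c c0 rho x Ax /=; rewrite pm_refl ?mulr0. Qed.
Next Obligation. by move=> c c0 rho x y Ax Ay /=; rewrite pm_sym. Qed.
Next Obligation.
by move=> c c0 rho x y z Ax Ay Az /=; rewrite -mulrDr ler_wpM2l ?pm_triangle.
Qed.
Next Obligation.
move=> c c0 rho p; apply: cvgM; first exact: cvg_cst.
exact: (@pm_cont _ _ rho p).
Qed.

Program Definition pm_add rho lam (e : pm_dom rho = pm_dom lam) : PM R X :=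
  @MkPM R X (pm_dom rho) (fun x y => rho x y + lam x y)
    (@pm_dom_compact _ _ rho) (pm_dom_nonempty rho) _ _ _ _ _ _.
Next Obligation.
by move=> rho lam e x y nA /=; rewrite !pm_off ?addr0 // -e.
Qed.
Next Obligation.
by move=> rho lam e x y Ax Ay; rewrite addr_ge0 // pm_ge0 // -e.
Qed.
Next Obligation.
by move=> rho lam e x Ax /=; rewrite !pm_refl ?addr0 // -e.
Qed.
Next Obligation.
move=> rho lam e x y Ax Ay /=.
by rewrite pm_sym // [lam x y]pm_sym // -e.
Qed.
Next Obligation.
by move=> rho lam e x y z Ax Ay Az /=; rewrite addrACA lerD ?pm_triangle // -e.
Qed.
Next Obligation.
move=> rho lam e p; apply: cvgD; first exact: (@pm_cont _ _ rho p).
by have := @pm_cont _ _ lam; rewrite -e => /(_ p).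
Qed.

(* As a type, [PM_full] carries the subspace topology inherited from [PM]. *)
Definition PM_full : set (PM R X) := [set rho | pm_dom rho = [set: X]].

Definition pm_norm rho : R :=
  sup [set rho p.1 p.2 | p in pm_dom rho `*` pm_dom rho].

End PM_theory.
Arguments PM_full : clear implicits.

Section operators.
Variables (R : realType) (X : topologicalType).
Implicit Types rho lam : PM R X.

(* Two elements of [PM_full] are equal as soon as they agree at all x, y. *)
Definition linear_operator (u : PM R X -> PM_full R X) : Prop :=
  (forall (c : R) (c0 : 0 <= c) rho (x y : X),
     set_val (u (pm_scale c0 rho)) x y = c * set_val (u rho) x y) /\
  (forall rho lam (e : pm_dom rho = pm_dom lam) (x y : X),
     set_val (u (pm_add e)) x y = set_val (u rho) x y + set_val (u lam) x y).

Definition regular_operator (u : PM R X -> PM_full R X) : Prop :=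
  forall rho, pm_norm (set_val (u rho)) = pm_norm rho.

Definition extension_operator (u : PM R X -> PM_full R X) : Prop :=
  forall rho (x y : X), pm_dom rho x -> pm_dom rho y ->
    set_val (u rho) x y = rho x y.

End operators.

(* Main.v *)
(** Let A be the domain of rho.  Every x in X is assigned a random point of A,
    i.e. a function f_{A,x} from ]0, 1[ to A, in such a way that f_{A,x} = x when
    x is in A, and that f_{A,x}(w) depends continuously on (A, x, w) at every w
    outside a countable set.  Then
      u(rho)(x, y) = \int_{]0, 1[} rho (f_{A,x}(w), f_{A,y}(w)) dw
    is a pseudometric because both points use the same w, it is clearly linear
    in rho, bounded by the norm of rho, and equal to rho on A; its joint
    continuity in (rho, x, y) is dominated convergence.

    The random point follows a branch of a binary tree.  Step k decides whether
    the point has to be close to z_k or away from z_k, at scale r_k, where every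
    point of X is within r_k of z_k for arbitrarily small r_k.  The two options
    are taken with probabilities proportional to weights which depend
    continuously on (A, x), and which are positive exactly when some a in A with
    d(x, a) < 2 d(x, A) satisfies the constraints imposed so far; hence the
    random point stays in A and tends to x as d(x, A) tends to 0. *)
Require Import Defs.
From mathcomp Require Import all_boot all_order all_algebra.
From mathcomp Require Import all_classical all_reals topology normedtype.
From mathcomp Require Import interval_inference measure lebesgue_measure.
From mathcomp Require Import measurable_realfun lebesgue_integral.
From mathcomp Require Import lra.
Import Order.TTheory GRing.Theory Num.Theory.
Import numFieldNormedType.Exports.

Set Implicit Arguments.
Unset Strict Implicit.
Unset Printing Implicit Defensive.

Local Open Scope classical_set_scope.
Local Open Scope ring_scope.

(** * Distance to a set and weights of the branches *)

Section random_point.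
Variables (R : realType) (X : topologicalType) (d : X -> X -> R).
Hypothesis d_metric : is_metric d.
Variables (z : nat -> X) (r : nat -> R).
Hypothesis r_gt0 : forall k, 0 < r k.
Implicit Types (A B : set X) (x a : X) (s : seq bool) (w : R).

Let d_ge0 x y : 0 <= d x y. Proof. by case: d_metric. Qed.
Let dxx x : d x x = 0. Proof. by case: d_metric => _ /(_ x x)[_ ->]. Qed.
Let d_eq0 x y : d x y = 0 -> x = y. Proof. by case: d_metric => _ /(_ x y)[]. Qed.
Let dC x y : d x y = d y x. Proof. by case: d_metric. Qed.
Let d_tri x y t : d x t <= d x y + d y t. Proof. by case: d_metric. Qed.

Definition dist x A : R := inf [set d x a | a in A].

Let has_inf_dist x A : A !=set0 -> has_inf [set d x a | a in A].
Proof.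
by case=> a Aa; split; [exists (d x a), a|exists 0 => _ [b _ <-]].
Qed.

Lemma dist_ge0 x A : A !=set0 -> 0 <= dist x A.
Proof.
case=> a Aa; apply: lb_le_inf; first by exists (d x a), a.
by move=> _ [b _ <-].
Qed.

Lemma dist_le x A a : A a -> dist x A <= d x a.
Proof. by move=> Aa; apply: ge_inf; [exists 0 => _ [b _ <-]|exists a]. Qed.

Lemma dist0 x A : A x -> dist x A = 0.
Proof.
move=> Ax; apply/eqP; rewrite eq_le dist_ge0; last by exists x.
by rewrite -(dxx x) dist_le.
Qed.

(** One half of Hausdorff closeness; estimates are proved for each half and combined when passing to
    limits. *)
Definition near_sub (e : R) A B := forall a, A a -> exists2 b, B b & d a b < e.

Lemma dist_near_sub e A B x y : A !=set0 -> near_sub e A B ->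
  dist y B <= dist x A + d x y + e.
Proof.
move=> A0 AB; rewrite -lerBlDr -lerBlDr; apply: lb_le_inf.
  by case: A0 => a Aa; exists (d x a), a.
move=> _ [a Aa <-]; have [b Bb ab] := AB a Aa.
have := dist_le y Bb; have := d_tri y x b; have := d_tri x a b.
have := dC x y; lra.
Qed.

(* The list [s] is read from its end: its last entry is the first choice made.
   Choice number [k] is [true] when [a] is required to be within [2 * r k] of
   [z k], and [false] when it is required to be at distance at least [r k]. *)
Fixpoint score x (t : R) s a : R :=
  if s is b :: s' then
    Num.min (score x t s' a)
      (if b then 2 * r (size s') - d a (z (size s'))
       else d a (z (size s')) - r (size s'))
  else 2 * t - d x a.

Lemma score_le_nil x t s a : score x t s a <= 2 * t - d x a.
Proof. by elim: s => //= b s IH; rewrite ge_min IH. Qed.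

(** Only the innermost term involves [x] and [t], each term is 1-Lipschitz in [a], and a minimum
    preserves such bounds. *)
Lemma score_lip x t y t' s a b :
  score x t s a <= score y t' s b + (d x y + 2 * `|t - t'| + d a b).
Proof.
elim: s => [|c s IH] /=.
  have := ler_norm (t - t'); have := d_tri y x b; have := d_tri x a b.
  by have := dC x y; lra.
rewrite -lerBlDr le_min !lerBlDr ge_min IH /= ge_min; apply/orP; right.
have := normr_ge0 (t - t'); have := d_ge0 x y.
have := d_tri a b (z (size s)); have := d_tri b a (z (size s)).
by rewrite (dC b a); case: c; lra.
Qed.

(** As a supremum over [A], the weight inherits the Lipschitz bounds of [score], hence varies
    continuously with [A] and [x]. *)
Definition weight A x s : R :=
  sup [set Num.max 0 (score x (dist x A) s a) | a in A].

Let weight_ubound A x s : A !=set0 ->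
  ubound [set Num.max 0 (score x (dist x A) s a) | a in A] (2 * dist x A).
Proof.
move=> A0 _ [a Aa <-]; rewrite ge_max mulr_ge0 ?dist_ge0 //=.
by apply: le_trans (score_le_nil _ _ _ _) _; rewrite gerBl.
Qed.

Lemma score_le_weight A x s a : A a -> score x (dist x A) s a <= weight A x s.
Proof.
move=> Aa; apply: le_trans (_ : Num.max 0 (score x (dist x A) s a) <= _).
  by rewrite le_max lexx orbT.
apply: ub_le_sup; last by exists a.
by exists (2 * dist x A); apply: weight_ubound; exists a.
Qed.

Lemma weight_ge0 A x s : A !=set0 -> 0 <= weight A x s.
Proof.
case=> a Aa; apply: le_trans (_ : Num.max 0 (score x (dist x A) s a) <= _).
  by rewrite le_max lexx.
apply: ub_le_sup; last by exists a.
by exists (2 * dist x A); apply: weight_ubound; exists a.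
Qed.

Lemma weight_gt0P A x s : A !=set0 ->
  0 < weight A x s <-> exists2 a, A a & 0 < score x (dist x A) s a.
Proof.
move=> A0; split=> [|[a Aa a_gt0]]; last first.
  exact: lt_le_trans a_gt0 (score_le_weight _ _ Aa).
move=> /sup_gt; case.
  by case: A0 => a Aa; exists (Num.max 0 (score x (dist x A) s a)), a.
by move=> _ [a Aa <-]; rewrite lt_max ltxx => ?; exists a.
Qed.

Lemma weight_nil_gt0 A x : A !=set0 -> 0 < dist x A -> 0 < weight A x [::].
Proof.
move=> A0 t_gt0; apply/weight_gt0P => //.
have [_ [a Aa <-]] := inf_adherent t_gt0 (has_inf_dist x A0).
by rewrite -/(dist x A) => ?; exists a => //=; lra.
Qed.

Lemma weight_cons A x s b : A !=set0 -> weight A x (b :: s) <= weight A x s.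
Proof.
move=> A0; rewrite leNgt; apply/negP => /sup_gt; case.
  by case: A0 => a Aa; eexists; exists a.
move=> _ [a Aa <-]; rewrite lt_max ltNge weight_ge0 //= lt_min.
by rewrite ltNge score_le_weight.
Qed.

(** The two options overlap: a witness [a] for [s] stays one for [false] if its distance to the new
    centre exceeds [r k], and for [true] otherwise, since then it is below [2 * r k]. *)
Lemma weight_sum_gt0 A x s : A !=set0 -> 0 < weight A x s ->
  0 < weight A x (false :: s) + weight A x (true :: s).
Proof.
move=> A0 /weight_gt0P[] // a Aa sa.
have [h|h] := ltP (r (size s)) (d a (z (size s))).
  apply: ltr_wpDr; first exact: weight_ge0.
  by apply/weight_gt0P => //; exists a => //=; rewrite lt_min sa /=; lra.
apply: ltr_wpDl; first exact: weight_ge0.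
apply/weight_gt0P => //; exists a => //=; rewrite lt_min sa /=.
by have := r_gt0 (size s); lra.
Qed.

Lemma weight_near_sub e A B x y s : A !=set0 -> B !=set0 -> near_sub e A B ->
  weight A x s <= weight B y s + (d x y + 2 * `|dist x A - dist y B| + e).
Proof.
move=> A0 B0 AB; have e_ge0 : 0 <= e.
  case: A0 => a /AB[b _]; apply: contraTT; rewrite -ltNge -leNgt => /ltW h.
  exact: le_trans h (d_ge0 _ _).
apply: ge_sup; first by case: A0 => a Aa; eexists; exists a.
move=> _ [a Aa <-]; have [b Bb ab] := AB a Aa.
have := weight_ge0 y s B0; have := score_le_weight y s Bb.
have := score_lip x (dist x A) y (dist y B) s a b.
have := normr_ge0 (dist x A - dist y B); have := d_ge0 x y.
by rewrite ge_max => *; apply/andP; split; lra.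
Qed.

(** * Subdivision of the unit interval along the tree *)

(* The interval attached to [s] is [left, left + len[; those of [false :: s]
   and [true :: s] cut it in two, proportionally to their weights. *)
Definition ratio A x s : R :=
  weight A x (false :: s) / (weight A x (false :: s) + weight A x (true :: s)).

Fixpoint ileft_len A x s : R * R :=
  if s is b :: s' then
    let: (l, m) := ileft_len A x s' in let p := ratio A x s' in
    if b then (l + m * p, m * (1 - p)) else (l, m * p)
  else (0, 1).

(** The point at which the interval of [s] is cut. *)
Definition threshold A x s := (ileft_len A x (true :: s)).1.

(** The branch whose intervals contain [w]; a tie goes to [true] because the intervals are closed on
    the left. *)
Fixpoint word A x w (n : nat) : seq bool :=
  if n is n'.+1 then
    let s := word A x w n' in (threshold A x s <= w) :: s
  else [::].

Lemma size_word A x w n : size (word A x w n) = n.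
Proof. by elim: n => //= n ->. Qed.

(** Invariant: the interval of the current word contains [w] and has positive length. The part
    containing [w] is then not degenerate, so its share of the total weight, and with it its weight,
    is positive. *)
Lemma word_weight_gt0 A x w n : A !=set0 -> 0 < dist x A -> 0 <= w < 1 ->
  0 < weight A x (word A x w n).
Proof.
move=> A0 t_gt0 w01.
pose inv s := let: (l, m) := ileft_len A x s in
  [/\ 0 < weight A x s, 0 < m & l <= w < l + m].
suff : inv (word A x w n) by rewrite /inv; case: ileft_len => l m [].
elim: n => [|n]; rewrite /inv /=.
  by split => //; [exact: weight_nil_gt0|rewrite add0r].
rewrite /threshold /=; set s := word A x w n.
case E : (ileft_len A x s) => [l m] [s_gt0 m_gt0 /andP[lw wm]] /=.
have Q_gt0 := weight_sum_gt0 A0 s_gt0.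
have pE : ratio A x s * (weight A x (false :: s) + weight A x (true :: s))
    = weight A x (false :: s) by rewrite /ratio mulfVK ?gt_eqF.
have w0 := weight_ge0 x (false :: s) A0; have w1 := weight_ge0 x (true :: s) A0.
set p := ratio A x s in pE *.
case: (leP (l + m * p) w) => h.
  have q_gt0 : 0 < 1 - p.
    have : 0 < m * (1 - p) by lra.
    by rewrite pmulr_rgt0.
  split; [|by rewrite mulr_gt0|by rewrite h /=; lra].
  have : 0 < (1 - p) * (weight A x (false :: s) + weight A x (true :: s)).
    by rewrite mulr_gt0.
  by rewrite mulrBl pE; lra.
have p_gt0 : 0 < p by rewrite -(pmulr_rgt0 _ m_gt0); lra.
split; [|by rewrite mulr_gt0|by rewrite lw].
by rewrite -pE mulr_gt0.
Qed.

(** * The random point determined by a branch *)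

Definition candidates A x w : set X :=
  [set a | A a /\ forall n, 0 <= score x (dist x A) (word A x w n) a].

(** For [x] in [A] all weights vanish and there may be no candidate; the default [x] is then the
    right value. *)
Definition random_point A x w : X := xget x (candidates A x w).

Lemma random_point_dist A x w : A !=set0 ->
  d x (random_point A x w) <= 2 * dist x A.
Proof.
move=> A0; rewrite /random_point; case: xgetP => [_ -> [_ /(_ 0%N)] /=|_].
  by rewrite subr_ge0.
by rewrite dxx mulr_ge0 ?dist_ge0.
Qed.

Lemma random_point_id A x w : A x -> random_point A x w = x.
Proof.
move=> Ax; apply/esym/d_eq0/eqP; rewrite eq_le d_ge0 andbT.
by have := @random_point_dist A x w (ex_intro _ x Ax); rewrite dist0 // mulr0.
Qed.


Hypothesis d_nbhs : forall x A,
  nbhs x A <-> exists2 e : R, 0 < e & [set y | d x y < e] `<=` A.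
Hypothesis zr_dense : forall x (e : R), 0 < e -> exists k, d x (z k) < r k < e.

Let ball_nbhs x (e : R) : 0 < e -> nbhs x [set y | d x y < e].
Proof. by move=> e_gt0; apply/d_nbhs; exists e. Qed.

Lemma compact_accumulation A (a_ : nat -> X) : compact A -> (forall n, A (a_ n)) ->
  exists2 p, A p & forall e N, 0 < e -> exists2 n, (N <= n)%N & d p (a_ n) < e.
Proof.
move=> Ac Aa; have [|p [Ap pF]] := Ac (a_ @ \oo) _.
  by exists 0%N => // n _; exact: Aa.
exists p => // e N e_gt0.
have [|y [[n Nn <-] pn]] := pF (a_ @` [set n | (N <= n)%N]) _ _ (ball_nbhs p e_gt0).
  by exists N => // n Nn; exists n.
by exists n.
Qed.

Lemma dist_gt0 x A : compact A -> A !=set0 -> ~ A x -> 0 < dist x A.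
Proof.
move=> Ac A0 nAx; rewrite lt_neqAle dist_ge0 // andbT; apply/negP => /eqP t0.
have /choice[a_ a_P] : forall n : nat, exists a, A a /\ d x a < n.+1%:R^-1.
  move=> n.
  have n_gt0 : 0 < n.+1%:R^-1 :> R by rewrite invr_gt0.
  have [_ [a Aa <-]] := inf_adherent n_gt0 (has_inf_dist x A0).
  by rewrite -/(dist x A) -t0 add0r; exists a.
have [|p Ap pa] := @compact_accumulation A a_ Ac; first by move=> n; case: (a_P n).
apply: nAx; suff -> : x = p by [].
apply/d_eq0/eqP; rewrite eq_le d_ge0 andbT leNgt; apply/negP => xp.
have h_gt0 : 0 < d x p / 2 by rewrite divr_gt0.
have [N _ Nh] := near_infty_natSinv_lt (PosNum h_gt0).
have [n Nn pn] := pa _ N h_gt0.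
have nh : n.+1%:R^-1 < d x p / 2 := Nh n Nn.
have [_ xn] := a_P n; have := d_tri x (a_ n) p; rewrite (dC (a_ n)) => h.
suff : d x p < d x p by rewrite ltxx.
apply: le_lt_trans h _; rewrite [ltRHS](splitr (d x p)) ltrD //.
exact: lt_trans xn nh.
Qed.

Lemma score_word_nonincreasing A x w (t : R) a m n : (m <= n)%N ->
  score x t (word A x w n) a <= score x t (word A x w m) a.
Proof.
move=> /subnK <-; elim: (n - m)%N => // k IH.
by rewrite addSn /= ge_min IH.
Qed.

(** Each prefix of the branch has a strict witness in [A]. An accumulation point of these witnesses
    satisfies every constraint weakly: late witnesses satisfy the earlier constraints too, and
    [score] is Lipschitz in the point. *)
Lemma candidates_neq0 A x w : compact A -> A !=set0 -> 0 < dist x A ->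
  0 <= w < 1 -> candidates A x w !=set0.
Proof.
move=> Ac A0 t_gt0 w01.
have /choice[a_ a_P] : forall n, exists a, A a /\
    0 < score x (dist x A) (word A x w n) a.
  move=> n.
  have /weight_gt0P[//|a Aa sa] := word_weight_gt0 n A0 t_gt0 w01.
  by exists a.
have [|p Ap pa] := @compact_accumulation A a_ Ac; first by move=> n; case: (a_P n).
exists p; split=> // n; rewrite leNgt; apply/negP => sp.
have sp' : 0 < - score x (dist x A) (word A x w n) p by rewrite oppr_gt0.
have [m nm pm] := pa _ n sp'.
have := score_lip x (dist x A) x (dist x A) (word A x w n) (a_ m) p.
have := @score_word_nonincreasing A x w (dist x A) (a_ m) _ _ nm.
have [_] := a_P m; rewrite dxx subrr normr0 dC; lra.
Qed.

Lemma random_point_candidates A x w : compact A -> A !=set0 -> 0 < dist x A ->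
  0 <= w < 1 -> candidates A x w (random_point A x w).
Proof.
move=> Ac A0 t_gt0 w01; exact: (xgetPex x (candidates_neq0 Ac A0 t_gt0 w01)).
Qed.

Lemma random_point_in A x w : compact A -> A !=set0 -> 0 <= w < 1 ->
  A (random_point A x w).
Proof.
move=> Ac A0 w01; have [Ax|nAx] := pselect (A x).
  by rewrite random_point_id.
by have [] := random_point_candidates Ac A0 (dist_gt0 Ac A0 nAx) w01.
Qed.

(** Take [k] with [z k] at distance less than [r k] from the random point and [r k < e / 3]. Choice
    [k] must be [true], as [false] would exclude the random point; so any [b] meeting the
    constraints is within [2 * r k] of [z k]. Leaving [y] and [t] free allows use at nearby
    parameters. *)
Lemma word_small A x w (e : R) : compact A -> A !=set0 -> 0 < dist x A ->
  0 <= w < 1 -> 0 < e -> exists n, forall y t b,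
  0 <= score y t (word A x w n) b -> d (random_point A x w) b < e.
Proof.
move=> Ac A0 t_gt0 w01 e_gt0.
have [_] := random_point_candidates Ac A0 t_gt0 w01.
set p := random_point A x w => pcand.
have e3 : 0 < e / 3 by rewrite divr_gt0.
have [k /andP[pk ke]] := zr_dense p e3; exists k.+1 => y t b.
have := pcand k.+1; rewrite /= !le_min !size_word => /andP[_ h1] /andP[_ h2].
have := d_tri p (z k) b; rewrite (dC (z k)).
by case: ifP h1 h2 => _; lra.
Qed.

(** * Continuity of the random point in the set, the point and the parameter *)

Section convergence.
Variables (I : Type) (F : set_system I) (FF : Filter F).
Variables (A_ : I -> set X) (x_ : I -> X) (A : set X) (x : X).
Hypotheses (A_neq0 : forall i, A_ i !=set0) (A0 : A !=set0).
Hypothesis A_cvg : forall e : R, 0 < e ->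
  \forall i \near F, near_sub e A (A_ i) /\ near_sub e (A_ i) A.
Hypothesis x_cvg : forall e : R, 0 < e -> \forall i \near F, d x (x_ i) < e.

Lemma cvg_dist : dist (x_ i) (A_ i) @[i --> F] --> dist x A.
Proof.
apply/cvgrPdist_le => e e_gt0; have e2 : 0 < e / 2 by rewrite divr_gt0.
near=> i.
have xi : d x (x_ i) < e / 2 by near: i; exact: x_cvg.
have [Ai iA] : near_sub (e / 2) A (A_ i) /\ near_sub (e / 2) (A_ i) A.
  by near: i; exact: A_cvg.
have := dist_near_sub x (x_ i) A0 Ai.
have := dist_near_sub (x_ i) x (A_neq0 i) iA.
by rewrite (dC (x_ i)) ler_norml => *; apply/andP; split; lra.
Unshelve. all: by end_near. Qed.

Lemma cvg_weight s : weight (A_ i) (x_ i) s @[i --> F] --> weight A x s.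
Proof.
apply/cvgrPdist_le => e e_gt0; have e4 : 0 < e / 4 by rewrite divr_gt0.
near=> i.
have xi : d x (x_ i) < e / 4 by near: i; exact: x_cvg.
have ti : `|dist x A - dist (x_ i) (A_ i)| <= e / 4.
  by near: i; move/cvgrPdist_le : cvg_dist; apply.
have [Ai iA] : near_sub (e / 4) A (A_ i) /\ near_sub (e / 4) (A_ i) A.
  by near: i; exact: A_cvg.
have := weight_near_sub x (x_ i) s A0 (A_neq0 i) Ai.
have := weight_near_sub (x_ i) x s (A_neq0 i) A0 iA.
rewrite (dC (x_ i)) (distrC (dist (x_ i) _)) ler_norml => *.
by apply/andP; split; lra.
Unshelve. all: by end_near. Qed.

Lemma cvg_ratio s : 0 < weight A x s ->
  ratio (A_ i) (x_ i) s @[i --> F] --> ratio A x s.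
Proof.
move=> s_gt0; apply: cvgM; first exact: cvg_weight.
apply: cvgV; first by rewrite gt_eqF // weight_sum_gt0.
by apply: cvgD; exact: cvg_weight.
Qed.

Lemma cvg_ileft_len s : 0 < weight A x (behead s) ->
  (ileft_len (A_ i) (x_ i) s).1 @[i --> F] --> (ileft_len A x s).1 /\
  (ileft_len (A_ i) (x_ i) s).2 @[i --> F] --> (ileft_len A x s).2.
Proof.
elim: s => [_|b s IH /= s_gt0]; first by split; exact: cvg_cst.
have [|cl cm] := IH.
  (* Weights decrease along a branch, so positivity passes to all shorter words and every ratio
     involved has a nonzero denominator. *)
  by case: (s) s_gt0 => // c s' /lt_le_trans; apply; exact: weight_cons.
have cp := cvg_ratio s_gt0.
have E B y : ileft_len B y (b :: s) =
   if b then ((ileft_len B y s).1 + (ileft_len B y s).2 * ratio B y s,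
              (ileft_len B y s).2 * (1 - ratio B y s))
   else ((ileft_len B y s).1, (ileft_len B y s).2 * ratio B y s).
  by rewrite /=; case: ileft_len.
split; under eq_fun do rewrite -/(ileft_len _ _ (b :: s)) E;
  rewrite -/(ileft_len _ _ (b :: s)) E; case: b {E} => //=.
- by apply: cvgD => //; exact: cvgM.
- by apply: cvgM => //; apply: cvgB => //; exact: cvg_cst.
- exact: cvgM.
Qed.

Lemma cvg_threshold s : 0 < weight A x s ->
  threshold (A_ i) (x_ i) s @[i --> F] --> threshold A x s.
Proof. by move=> s_gt0; have [] := @cvg_ileft_len (true :: s) s_gt0. Qed.

Variables (w_ : I -> R) (w : R).
Hypotheses (w_cvg : w_ i @[i --> F] --> w) (w01 : 0 < w < 1).
Hypothesis w_generic : forall s, w != threshold A x s.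

(** Since [w] avoids all thresholds, each comparison made along the branch is strict and persists
    under small perturbations. *)
Lemma near_word n : 0 < dist x A ->
  \forall i \near F, word (A_ i) (x_ i) (w_ i) n = word A x w n.
Proof.
move=> t_gt0; elim: n => [|n IH] /=; first exact: nearW.
set s := word A x w n.
have s_gt0 : 0 < weight A x s.
  apply: word_weight_gt0 => //.
  by have /andP[w_gt0 w_lt1] := w01; rewrite ltW.
have : w_ i - threshold (A_ i) (x_ i) s @[i --> F] --> w - threshold A x s.
  by apply: cvgB => //; exact: cvg_threshold.
move=> /cvgrPdist_lt /(_ `|w - threshold A x s|) h.
have {}h := h (ltac:(by rewrite normr_gt0 subr_eq0)).
near=> i.
have -> : word (A_ i) (x_ i) (w_ i) n = s by near: i.
have : `|w - threshold A x s - (w_ i - threshold (A_ i) (x_ i) s)| <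
  `|w - threshold A x s| by near: i.
case: (lerP (threshold A x s) w) => hw; rewrite ltr_norml => /andP[h1 h2];
  congr (_ :: _).
- by apply/idP; lra.
- by apply/negbTE; rewrite -ltNge; lra.
Unshelve. all: by end_near. Qed.

Hypotheses (A_compact : forall i, compact (A_ i)) (Ac : compact A).

(** If [x] is in [A], the random point is within [2 * dist] of [x_ i], and this distance tends to 0.
    Otherwise long prefixes of the two branches eventually agree, and [word_small] confines both
    points. *)
Lemma cvg_random_point (e : R) : 0 < e -> \forall i \near F,
  d (random_point A x w) (random_point (A_ i) (x_ i) (w_ i)) < e.
Proof.
move=> e_gt0; have /andP[w_gt0 w_lt1] := w01.
have w01' : 0 <= w < 1 by rewrite ltW.
have [Ax|nAx] := pselect (A x).
  rewrite random_point_id //.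
  have e3 : 0 < e / 3 by rewrite divr_gt0.
  have := cvg_dist; rewrite (dist0 Ax) => /cvgrPdist_lt/(_ _ e3) hd.
  near=> i.
  have xi : d x (x_ i) < e / 3 by near: i; exact: x_cvg.
  have : `|0 - dist (x_ i) (A_ i)| < e / 3 by near: i.
  have := @random_point_dist (A_ i) (x_ i) (w_ i) (A_neq0 i).
  have := d_tri x (x_ i) (random_point (A_ i) (x_ i) (w_ i)).
  rewrite sub0r normrN ger0_norm ?dist_ge0 //; lra.
have t_gt0 := dist_gt0 Ac A0 nAx.
have [n hn] := word_small Ac A0 t_gt0 w01' e_gt0.
near=> i.
have wi : word (A_ i) (x_ i) (w_ i) n = word A x w n by near: i; exact: near_word.
have ti : 0 < dist (x_ i) (A_ i).
  by near: i; exact: (cvgr_gt _ cvg_dist).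
have w01i : 0 <= w_ i < 1.
  apply/andP; split.
    by apply/ltW; near: i; exact: (cvgr_gt _ w_cvg).
  by near: i; exact: (cvgr_lt _ w_cvg).
apply: (hn (x_ i) (dist (x_ i) (A_ i))); rewrite -wi.
by have [_] := random_point_candidates (@A_compact i) (A_neq0 i) ti w01i.
Unshelve. all: by end_near. Qed.

End convergence.

End random_point.

(** * Finite nets and the choice of centres and radii *)

Lemma compact_metric_net (R : realType) (X : topologicalType) (d : X -> X -> R) :
  is_metric d ->
  (forall x A, nbhs x A <-> exists2 e : R, 0 < e & [set y | d x y < e] `<=` A) ->
  compact [set: X] ->
  forall e : R, 0 < e -> exists l : seq X, forall x, exists2 y, y \in l & d x y < e.
Proof.
move=> [_ _ dC _] d_nbhs /compact_near_coveringP Xc e e_gt0.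
(* Along finite lists ordered by inclusion, the near-covering form of compactness yields one list
   good for all points. *)
pose F := filter_from setT (fun l : seq X => [set l' : seq X | {subset l <= l'}]).
have FF : Filter F.
  apply: filter_from_filter; first by exists [::].
  move=> l m _ _; exists (l ++ m) => // k lmk; split=> x xl; apply: lmk;
    by rewrite mem_cat xl ?orbT.
have [|l _ lP] := Xc _ F (fun l x => exists2 y, y \in l & d x y < e) FF.
  move=> x _; exists ([set y | d x y < e], [set l' | {subset [:: x] <= l'}]).
    by split; [apply/d_nbhs; exists e|exists [:: x]].
  by move=> [y l] /= [xy xl]; exists x; [apply: xl; rewrite inE|rewrite dC].
by exists l => x; apply: (lP l).
Qed.

Lemma compact_metric_basis (R : realType) (X : topologicalType)
    (d : X -> X -> R) (x0 : X) :
  is_metric d ->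
  (forall x A, nbhs x A <-> exists2 e : R, 0 < e & [set y | d x y < e] `<=` A) ->
  compact [set: X] ->
  exists z : nat -> X, exists r : nat -> R, (forall k, 0 < r k) /\
    forall x (e : R), 0 < e -> exists k, d x (z k) < r k < e.
Proof.
move=> dm d_nbhs Xc.
have /choice[l lP] : forall n : nat, exists l : seq X,
    forall x, exists2 y, y \in l & d x y < n.+1%:R^-1.
  by move=> n; apply: compact_metric_net => //; rewrite invr_gt0.
(* The index [k] codes a pair: a scale and a position in the net of that scale. Codes of no pair and
   positions out of range get harmless defaults. *)
pose c k := odflt (0, 0)%N (unpickle k : option (nat * nat)).
exists (fun k => nth x0 (l (c k).1) (c k).2), (fun k => (c k).1.+1%:R^-1).
split=> [k|x e e_gt0]; first by rewrite invr_gt0.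
have [n _ /(_ n (leqnn n)) ne] := near_infty_natSinv_lt (PosNum e_gt0).
have [y yl xy] := lP n x.
exists (pickle (n, index y (l n))); rewrite /c pickleK /= nth_index //.
by rewrite xy.
Qed.

(** On the countable part every preimage is countable, hence measurable; on the rest the function is
    continuous. *)
Lemma measurable_fun_continuous_off_countable (R : realType) (D E : set R)
    (f : R -> R) : open D -> countable E ->
  (forall w, D w -> ~ E w -> {for w, continuous f}) -> measurable_fun D f.
Proof.
move=> oD cE fc.
have mD : measurable D := open_measurable oD.
have mE : measurable E by apply: countable_measurable.
rewrite -(setDUK (@subIsetl _ D E)) setDIr setDv set0U setUC.
apply/measurable_funU; [exact: measurableD|exact: measurableI|split].
  apply: subspace_continuous_measurable_fun; first exact: measurableD.
  by apply: continuous_in_subspaceT => w; rewrite inE => -[]; exact: fc.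
move=> _ B mB; apply: countable_measurable => //.
by apply: sub_countable cE; apply: subset_card_le => w [[]].
Qed.

Lemma vietoris_nbhs (Y : topologicalType) (A : hyperspace Y)
    (V : set (hyperspace Y)) :
  nbhs A V <-> exists Us, [/\ vietoris_dom Us, vietoris_base Us A &
    vietoris_base Us `<=` V].
Proof.
split=> [|[Us [oU AU UV]]].
  rewrite nbhsE => -[B [[D Ddom <-] [Us DU AU] BV]].
  exists Us; split=> //; first exact: Ddom.
  by move=> C CU; apply: BV; exists Us.
exists (vietoris_base Us); split=> //.
by exists [set Us] => [? -> //|]; rewrite bigcup_set1.
Qed.

(** * Neighbourhoods in the space of partial pseudometrics *)

Section extension.
Variables (R : realType) (X : topologicalType) (d : X -> X -> R).
Hypothesis d_metric : is_metric d.
Hypothesis d_nbhs : forall x A,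
  nbhs x A <-> exists2 e : R, 0 < e & [set y | d x y < e] `<=` A.
Hypothesis X_compact : compact [set: X].
Variables (z : nat -> X) (r : nat -> R).
Hypothesis r_gt0 : forall k, 0 < r k.
Hypothesis zr_dense : forall x (e : R), 0 < e -> exists k, d x (z k) < r k < e.
Implicit Types rho lam : PM R X.

Let dC x y : d x y = d y x. Proof. by case: d_metric. Qed.
Let d_tri x y t : d x t <= d x y + d y t. Proof. by case: d_metric. Qed.
Let dxx x : d x x = 0. Proof. by case: d_metric => _ /(_ x x)[_ ->]. Qed.
Let ball_nbhs x (e : R) : 0 < e -> nbhs x [set y | d x y < e].
Proof. by move=> e_gt0; apply/d_nbhs; exists e. Qed.

Lemma pm_contP rho a b (e : R) : pm_dom rho a -> pm_dom rho b -> 0 < e ->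
  exists2 del : R, 0 < del & forall a' b', pm_dom rho a' -> pm_dom rho b' ->
    d a a' < del -> d b b' < del -> `|rho a b - rho a' b'| < e.
Proof.
move=> Aa Ab e_gt0.
have /subspace_continuousP/(_ (a, b) (conj Aa Ab)) := @pm_cont _ _ rho.
move=> /cvgrPdist_lt/(_ e e_gt0) [[U V] /= [/d_nbhs[u u0 uU] /d_nbhs[v v0 vV]] UV].
exists (Num.min u v); first by rewrite lt_min u0.
move=> a' b' Aa' Ab'; rewrite !lt_min => /andP[au _] /andP[_ bv].
by apply: (UV (a', b')); split=> //=; [exact: uU|exact: vV].
Qed.

Lemma pm_bounded rho : exists2 M : R, 0 <= M & forall a b,
  pm_dom rho a -> pm_dom rho b -> rho a b <= M.
Proof.
have := continuous_compact (@pm_cont _ _ rho)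
  (compact_setX (@pm_dom_compact _ _ rho) (@pm_dom_compact _ _ rho)).
move=> /compact_bounded[M [_ hM]].
exists (`|M| + 1); first by rewrite addr_ge0.
move=> a b Aa Ab; apply: le_trans (ler_norm _) _.
apply: (hM (`|M| + 1)); first by rewrite ltr_pwDr // ler_norm.
by exists (a, b).
Qed.

(** A one-sided Hausdorff closeness of graphs: points of the graph of [lam] are near that of [rho],
    while in the other direction only domains are compared. *)
Definition near_pm (e : R) rho lam :=
  near_sub d e (pm_dom rho) (pm_dom lam) /\
  forall a b, pm_dom lam a -> pm_dom lam b -> exists a' b',
    [/\ pm_dom rho a', pm_dom rho b', d a a' < e, d b b' < e &
        `|lam a b - rho a' b'| < e].

Lemma near_pm_refl rho (e : R) : 0 < e -> near_pm e rho rho.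
Proof.
move=> e_gt0; split=> [a Aa|a b Aa Ab]; first by exists a; rewrite ?dxx.
by exists a, b; rewrite !dxx subrr normr0.
Qed.

Lemma near_pm_sub rho lam (e : R) : near_pm e rho lam ->
  near_sub d e (pm_dom rho) (pm_dom lam) /\
  near_sub d e (pm_dom lam) (pm_dom rho).
Proof.
case=> h1 h2; split=> // a Aa; have [a' [_ [? _ ? _ _]]] := h2 a a Aa Aa.
by exists a'.
Qed.

Lemma near_pm_le rho lam (e e' : R) : e <= e' -> near_pm e rho lam ->
  near_pm e' rho lam.
Proof.
move=> ee' [h1 h2]; split=> [a /h1[b Bb ab]|a b Ba Bb].
  by exists b => //; exact: lt_le_trans ee'.
have [a' [b' [Aa' Ab' aa' bb' ab]]] := h2 a b Ba Bb; exists a', b'.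
by split=> //; apply: lt_le_trans ee'.
Qed.


Lemma pm_graph_nbhs rho (V : set (hyperspace (X * X * R)%type)) :
  nbhs (pm_graph rho) V -> \forall lam \near rho, V (pm_graph lam).
Proof. exact: (@initial_continuous (PM R X) _ (@pm_graph R X) rho). Qed.

Lemma near_pm_nbhs rho (e : R) : 0 < e -> \forall lam \near rho, near_pm e rho lam.
Proof.
move=> e_gt0; have e2 : 0 < e / 2 by rewrite divr_gt0.
have e2e : e / 2 + e / 2 = e by rewrite -splitr.
near=> lam; split; near: lam.
  have /compact_near_coveringP Ac := @pm_dom_compact _ _ rho.
  apply: (Ac _ _ (fun lam a => exists2 b, pm_dom lam b & d a b < e)) => a Aa.
  (* Using [nbhs] here puts [p.1.1] in the interior of the ball, which makes [U] open. With [setT]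
     in the list below, the only real condition is that the graph meets [U]. *)
  pose U : set (X * X * R) := [set p | nbhs p.1.1 [set y | d a y < e / 2]].
  have oU : open U.
    rewrite openE => -[[p q] v] /= Up.
    have : nbhs p ([set y | d a y < e / 2]^°) by exact: nbhs_interior.
    move=> Vp; exists ([set p' | ([set y | d a y < e / 2]^°) p'.1], setT) => //=.
      split; last exact: filterT.
      exists ([set y | d a y < e / 2]^°, setT) => //=; last by case=> ? ? [].
      by split=> //; exact: filterT.
    by move=> [[p' q'] v'] [].
  have : \forall lam \near rho, vietoris_base [:: setT; U] (pm_graph lam).
    apply: pm_graph_nbhs; apply/vietoris_nbhs; exists [:: setT; U]; split=> //.
      by move=> W; rewrite !inE => /orP[]/eqP-> //; exact: openT.
    split=> [p _|W]; first by exists setT => //=; rewrite !inE eqxx.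
    rewrite !inE => /orP[]/eqP->; rewrite ?setIT; exists (a, a, rho a a).
      by exists (a, a).
    by split; [exists (a, a)|exact: ball_nbhs].
  move=> near_hit; exists ([set y | d a y < e / 2],
      [set lam | vietoris_base [:: setT; U] (pm_graph lam)]).
    by split => //; exact: ball_nbhs.
  move=> [a' lam] /= [aa' [_ /(_ U)]]; rewrite !inE eqxx orbT => /(_ isT).
  move=> [_ [[[p q] /= [lp _] <-] /= /nbhs_singleton /= ap]]; exists p => //.
  by have := d_tri a' a p; rewrite (dC a' a); lra.
(* For the other half, [U] is an open neighbourhood of the graph of [rho], and nearby graphs lie
   inside it. *)
pose U : set (X * X * R) := [set p | exists a b, [/\ pm_dom rho a, pm_dom rho b,
  d p.1.1 a < e, d p.1.2 b < e & `|p.2 - rho a b| < e]].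
have oU : open U.
  rewrite openE => -[[p q] v] /= [a [b [Aa Ab pa qb vab]]].
  have tp : 0 < e - d p a by rewrite subr_gt0.
  have tq : 0 < e - d q b by rewrite subr_gt0.
  have tv : 0 < e - `|v - rho a b| by rewrite subr_gt0.
  exists ([set p' | d p p'.1 < e - d p a /\ d q p'.2 < e - d q b],
          ball v (e - `|v - rho a b|)) => /=.
    split; last exact: nbhsx_ballx.
    exists ([set y | d p y < e - d p a], [set y | d q y < e - d q b]) => //=.
    by split; exact: ball_nbhs.
  move=> [[p' q'] v'] /= [[pp' qq']]; rewrite -ball_normE /= => vv'.
  exists a, b; split=> //=.
  - by have := d_tri p' p a; rewrite (dC p' p); lra.
  - by have := d_tri q' q b; rewrite (dC q' q); lra.
  - have := ler_distD v v' (rho a b); rewrite (distrC v' v); lra.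
have : \forall lam \near rho, vietoris_base [:: U] (pm_graph lam).
  apply: pm_graph_nbhs; apply/vietoris_nbhs; exists [:: U].
  have AU : pm_graph rho `<=` U.
    move=> _ [[a b] /= [Aa Ab] <-]; exists a, b => /=.
    by split=> //; rewrite ?dxx // subrr normr0.
  split=> //; first by move=> W; rewrite inE => /eqP->.
  split=> [p Ap|W]; first by exists U; [rewrite /= inE|exact: AU].
  rewrite inE => /eqP ->; have [p Ap] := hset_nonempty (pm_graph rho).
  by exists p; split=> //; exact: AU.
apply: filterS => lam [lamU _] a b la lb.
have [|W] := lamU (a, b, lam a b); first by exists (a, b).
by rewrite /= inE => /eqP-> [a' [b' ?]]; exists a', b'.
Unshelve. all: by end_near. Qed.

(** * The extension as an integral *)

Local Notation rp := (random_point d z r).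
Local Notation generic A x w := (forall s, w != threshold d z r A x s).

Definition integrand rho x y (w : R) : R :=
  rho (rp (pm_dom rho) x w) (rp (pm_dom rho) y w).

(** The random points converge, but [rho] need not be defined at those of [rho_ i]. [near_pm] moves
    them to points of the domain of [rho] with nearly the same value, where continuity of [rho]
    applies. *)
Lemma cvg_integrand (I : Type) (F : set_system I) (FF : Filter F)
    (rho_ : I -> PM R X) (x_ y_ : I -> X) (w_ : I -> R) rho x y (w : R) :
  (forall e : R, 0 < e -> \forall i \near F, near_pm e rho (rho_ i)) ->
  (forall e : R, 0 < e -> \forall i \near F, d x (x_ i) < e) ->
  (forall e : R, 0 < e -> \forall i \near F, d y (y_ i) < e) ->
  w_ i @[i --> F] --> w -> 0 < w < 1 ->
  generic (pm_dom rho) x w -> generic (pm_dom rho) y w ->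
  integrand (rho_ i) (x_ i) (y_ i) (w_ i) @[i --> F] --> integrand rho x y w.
Proof.
move=> rhoF xF yF wF w01 gx gy.
have A_cvg (e : R) : 0 < e -> \forall i \near F,
    near_sub d e (pm_dom rho) (pm_dom (rho_ i)) /\
    near_sub d e (pm_dom (rho_ i)) (pm_dom rho).
  by move=> /rhoF; apply: filterS => i; exact: near_pm_sub.
have cvg_rp x' (x'_ : I -> X)
    (x'F : forall e : R, 0 < e -> \forall i \near F, d x' (x'_ i) < e)
    (gx' : generic (pm_dom rho) x' w) :=
  @cvg_random_point R X d d_metric z r r_gt0 d_nbhs zr_dense I F FF
    (fun i => pm_dom (rho_ i)) x'_ (pm_dom rho) x'
    (fun i => pm_dom_nonempty (rho_ i)) (pm_dom_nonempty rho) A_cvg x'F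
    w_ w wF w01 gx'
    (fun i => @pm_dom_compact _ _ (rho_ i)) (@pm_dom_compact _ _ rho).
have /andP[w_gt0 w_lt1] := w01.
have w01' : 0 <= w < 1 by rewrite ltW.
set a := rp (pm_dom rho) x w; set b := rp (pm_dom rho) y w.
have rpA lam t v : 0 <= v < 1 -> pm_dom lam (rp (pm_dom lam) t v).
  move=> v01; apply: random_point_in => //; first exact: pm_dom_compact.
  exact: pm_dom_nonempty.
apply/cvgrPdist_lt => e e_gt0; have e2 : 0 < e / 2 by rewrite divr_gt0.
have [del del_gt0 delP] := pm_contP (rpA rho x w w01') (rpA rho y w w01') e2.
have del2 : 0 < del / 2 by rewrite divr_gt0.
near=> i.
have w_01 : 0 <= w_ i < 1.
  apply/andP; split.
    by apply/ltW; near: i; exact: (cvgr_gt _ wF).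
  by near: i; exact: (cvgr_lt _ wF).
have aa_ : d a (rp (pm_dom (rho_ i)) (x_ i) (w_ i)) < del / 2.
  by near: i; exact: (cvg_rp x x_ xF gx _ del2).
have bb_ : d b (rp (pm_dom (rho_ i)) (y_ i) (w_ i)) < del / 2.
  by near: i; exact: (cvg_rp y y_ yF gy _ del2).
have [_ /(_ _ _ (rpA (rho_ i) (x_ i) _ w_01) (rpA (rho_ i) (y_ i) _ w_01))] :
    near_pm (Num.min (e / 2) (del / 2)) rho (rho_ i).
  by near: i; apply: rhoF; rewrite lt_min e2.
move: aa_ bb_; set a_ := rp _ (x_ i) _; set b_ := rp _ (y_ i) _ => aa_ bb_.
move=> [a' [b' [Aa' Ab']]]; rewrite !lt_min.
move=> /andP[_ aa'] /andP[_ bb'] /andP[ab' _].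
have := delP a' b' Aa' Ab'; rewrite -/a -/b => h.
have {}h : `|rho a b - rho a' b'| < e / 2.
  by apply: h; [have := d_tri a a_ a'|have := d_tri b b_ b']; lra.
rewrite /integrand -/a -/b -/a_ -/b_.
have := ler_distD (rho a' b') (rho a b) (rho_ i a_ b_).
by rewrite (distrC (rho a' b') (rho_ i a_ b_)); lra.
Unshelve. all: by end_near. Qed.

Local Notation D := (`]0, 1[%classic : set R).
Local Notation mu := (@lebesgue_measure R).

Let mu_D : mu D = 1%E.
Proof. by rewrite lebesgue_measure_itv /= lte_fin ltr01 sube0. Qed.

Definition thresholds A x y : set R :=
  \bigcup_s [set threshold d z r A x s; threshold d z r A y s].

Lemma countable_thresholds A x y : countable (thresholds A x y).
Proof.
apply: bigcup_countable => [|s _]; first exact: countableP.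
exact/finite_set_countable/finite_set2.
Qed.

Lemma notin_thresholds A x y w : ~ thresholds A x y w ->
  generic A x w /\ generic A y w.
Proof.
by move=> nw; split=> s; apply/eqP => ws; apply: nw; exists s; [|left| |right].
Qed.

Lemma measurable_integrand rho x y : measurable_fun D (integrand rho x y).
Proof.
apply: (@measurable_fun_continuous_off_countable R D
  (thresholds (pm_dom rho) x y)).
- exact: interval_open.
- exact: countable_thresholds.
- move=> w; rewrite /= in_itv /= => w01 /notin_thresholds[gx gy].
  by apply: (@cvg_integrand _ _ _ (fun=> rho) (fun=> x) (fun=> y) id) => //
    e e_gt0; apply: nearW => ?; rewrite ?dxx //; exact: near_pm_refl.
Qed.

Lemma random_point_dom rho x w : D w ->
  pm_dom rho (rp (pm_dom rho) x w).
Proof.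
rewrite /= in_itv /= => /andP[w_gt0 w_lt1].
apply: random_point_in => //; last by rewrite ltW.
  exact: pm_dom_compact.
exact: pm_dom_nonempty.
Qed.

Lemma integrand_ge0 rho x y w : D w -> 0 <= integrand rho x y w.
Proof. by move=> Dw; apply: pm_ge0; exact: random_point_dom. Qed.

Lemma integrable_integrand rho x y :
  mu.-integrable D (EFin \o integrand rho x y).
Proof.
apply: measurable_bounded_integrable => //.
- by rewrite [X in (X < _)%E]mu_D ltry.
- exact: measurable_integrand.
have [M _ rhoM] := pm_bounded rho; exists M; split; first exact: num_real.
move=> M' MM' w Dw /=; rewrite ger0_norm ?integrand_ge0 //.
by apply: le_trans (ltW MM'); apply: rhoM; exact: random_point_dom.
Qed.

Definition extension rho x y : R := \int[mu]_(w in D) integrand rho x y w.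

(** Dominated convergence: the integrands converge off the thresholds, a countable and hence null
    set, and [near_pm 1] bounds all of them by [M + 1]. *)
Lemma cvg_extension_seq (rho_ : nat -> PM R X) (x_ y_ : nat -> X) rho x y :
  (forall n, near_pm 1 rho (rho_ n)) ->
  (forall e : R, 0 < e -> \forall n \near \oo, near_pm e rho (rho_ n)) ->
  (forall e : R, 0 < e -> \forall n \near \oo, d x (x_ n) < e) ->
  (forall e : R, 0 < e -> \forall n \near \oo, d y (y_ n) < e) ->
  extension (rho_ n) (x_ n) (y_ n) @[n --> \oo] --> extension rho x y.
Proof.
move=> rho1 rhoF xF yF; have [M M_ge0 rhoM] := pm_bounded rho.
have mD : measurable D by [].
have [|||||_ _ h] := @dominated_convergence _ _ R mu D mD
  (fun n w => (integrand (rho_ n) (x_ n) (y_ n) w)%:E)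
  (fun w => (integrand rho x y w)%:E) (fun=> (M + 1)%:E).
- by move=> n; apply/measurable_EFinP; exact: measurable_integrand.
- by apply/measurable_EFinP; exact: measurable_integrand.
- exists (thresholds (pm_dom rho) x y); split.
  + by apply: countable_measurable => //; exact: countable_thresholds.
  + by apply: countable_lebesgue_measure0; exact: countable_thresholds.
  move=> w nw; apply: contrapT => /notin_thresholds[gx gy]; apply: nw.
  rewrite /= in_itv /= => w01; apply/cvg_EFin; first exact: nearW.
  by apply: cvg_integrand => //; exact: cvg_cst.
- apply/integrableP; split; first exact: measurable_cst.
  by rewrite integral_cst // [X in (_ * X)%E]mu_D mule1 ltry.
- apply: aeW => w n Dw; rewrite lee_fin ger0_norm ?integrand_ge0 //.
  have [_ /(_ _ _ (random_point_dom (rho_ n) (x_ n) Dw)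
    (random_point_dom (rho_ n) (y_ n) Dw))] := rho1 n.
  move=> [a [b [Aa Ab _ _ ab]]]; have := rhoM a b Aa Ab.
  by rewrite /integrand; move: ab; rewrite ltr_norml; lra.
apply: fine_cvg; rewrite /extension /Rintegral fineK //.
exact: (integrable_fin_num _ (integrable_integrand rho x y)).
Qed.

(** Dominated convergence speaks of sequences; counterexamples with [del] equal to [n.+1%:R^-1]
    would form a sequence contradicting it. *)
Lemma cvg_extension rho x y (e : R) : 0 < e ->
  exists2 del : R, 0 < del & forall lam x' y', near_pm del rho lam ->
    d x x' < del -> d y y' < del ->
    `|extension rho x y - extension lam x' y'| < e.
Proof.
move=> e_gt0; apply: contrapT => no_del.
have /choice[t tP] : forall n : nat, exists t : PM R X * X * X,
    [/\ near_pm n.+1%:R^-1 rho t.1.1, d x t.1.2 < n.+1%:R^-1,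
        d y t.2 < n.+1%:R^-1 &
        e <= `|extension rho x y - extension t.1.1 t.1.2 t.2|].
  move=> n; apply: contrapT => no_t; apply: no_del.
  exists n.+1%:R^-1; first by rewrite invr_gt0.
  move=> lam x' y' h1 h2 h3; rewrite ltNge; apply/negP => h4.
  by apply: no_t; exists (lam, x', y').
have small (e' : R) : 0 < e' -> \forall n \near \oo, n.+1%:R^-1 < e'.
  by move=> e'_gt0; exact: (near_infty_natSinv_lt (PosNum e'_gt0)).
have : extension (t n).1.1 (t n).1.2 (t n).2 @[n --> \oo] --> extension rho x y.
  apply: cvg_extension_seq.
  - move=> n; have [+ _ _ _] := tP n; apply: near_pm_le.
    by rewrite invf_le1 // ler1n.
  - move=> e' /small; apply: filterS => n /ltW ne.
    by have [+ _ _ _] := tP n; exact: near_pm_le.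
  - by move=> e' /small; apply: filterS => n; apply: lt_trans; have [] := tP n.
  - by move=> e' /small; apply: filterS => n; apply: lt_trans; have [] := tP n.
move=> /cvgrPdist_lt/(_ e e_gt0)[n _ /(_ n (leqnn n))] /=.
by have [_ _ _] := tP n; rewrite leNgt => /negP.
Qed.

(** * Pseudometric axioms, linearity and norm of the extension *)

Lemma extension_ge0 rho x y : 0 <= extension rho x y.
Proof. by apply: Rintegral_ge0 => w; exact: integrand_ge0. Qed.

Lemma extension_refl rho x : extension rho x x = 0.
Proof.
transitivity (\int[mu]_(w in D) (0 : R)); last by rewrite Rintegral_cst // mul0r.
by apply: eq_Rintegral => w /set_mem Dw; apply: pm_refl; exact: random_point_dom.
Qed.

Lemma extension_sym rho x y : extension rho x y = extension rho y x.
Proof.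
by apply: eq_Rintegral => w /set_mem Dw; apply: pm_sym; exact: random_point_dom.
Qed.

Lemma extension_triangle rho x y t :
  extension rho x t <= extension rho x y + extension rho y t.
Proof.
rewrite /extension -RintegralD //; try exact: integrable_integrand.
apply: le_Rintegral => //; first exact: integrable_integrand.
  exact: (integrableD _ (integrable_integrand rho x y)
    (integrable_integrand rho y t)).
by move=> w Dw; apply: pm_triangle; exact: random_point_dom.
Qed.

Lemma Rintegral_unit_cst (c : R) : \int[mu]_(w in D) c = c.
Proof.
by rewrite Rintegral_cst // [X in fine X]mu_D mulr1.
Qed.

Lemma extension_le rho x y (M : R) :
  (forall a b, pm_dom rho a -> pm_dom rho b -> rho a b <= M) ->
  extension rho x y <= M.
Proof.
move=> rhoM; rewrite -[leRHS]Rintegral_unit_cst; apply: le_Rintegral => //.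
- exact: integrable_integrand.
- apply/integrableP; split; first exact: measurable_cst.
  by rewrite /= integral_cst // [X in (_ * X)%E]mu_D mule1 ltry.
- by move=> w Dw; apply: rhoM; exact: random_point_dom.
Qed.

Lemma extension_id rho x y : pm_dom rho x -> pm_dom rho y ->
  extension rho x y = rho x y.
Proof.
move=> Ax Ay; rewrite -[RHS]Rintegral_unit_cst; apply: eq_Rintegral => w _.
by rewrite /integrand !random_point_id.
Qed.

Lemma extension_scale (c : R) (c0 : 0 <= c) rho x y :
  extension (pm_scale c0 rho) x y = c * extension rho x y.
Proof. by rewrite /extension -RintegralZl //; exact: integrable_integrand. Qed.

Lemma extension_add rho lam (e : pm_dom rho = pm_dom lam) x y :
  extension (pm_add e) x y = extension rho x y + extension lam x y.
Proof.
rewrite /extension -RintegralD //; try exact: integrable_integrand.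
by apply: eq_Rintegral => w _; rewrite /integrand /= -e.
Qed.

Lemma extension_continuous rho :
  {within setT `*` setT, continuous (fun p : X * X => extension rho p.1 p.2)}.
Proof.
apply: continuous_subspaceT => -[x y]; apply/cvgrPdist_lt => e /cvg_extension.
move=> /(_ rho x y)[del del_gt0 h].
exists ([set x' | d x x' < del], [set y' | d y y' < del]) => /=.
  by split; exact: ball_nbhs.
by move=> [x' y'] /= [xx' yy']; apply: h => //; exact: near_pm_refl.
Qed.

Lemma setT_neq0 rho : [set: X] !=set0.
Proof. by have [x _] := pm_dom_nonempty rho; exists x. Qed.

Definition pm_extension rho : PM R X :=
  @MkPM R X setT (extension rho) X_compact (setT_neq0 rho)
    (fun x y nxy => False_ind _ (nxy (conj I I)))
    (fun x y _ _ => extension_ge0 rho x y) (fun x _ => extension_refl rho x)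
    (fun x y _ _ => extension_sym rho x y)
    (fun x y t _ _ _ => extension_triangle rho x y t)
    (@extension_continuous rho).

(** An average of values of [rho] cannot exceed its norm, and the values of [rho] are among those of
    its extension. *)
Lemma pm_norm_extension rho : pm_norm (pm_extension rho) = pm_norm rho.
Proof.
have [a Aa] := pm_dom_nonempty rho; have [M _ rhoM] := pm_bounded rho.
have le_norm x y : pm_dom rho x -> pm_dom rho y -> rho x y <= pm_norm rho.
  move=> Ax Ay; apply: ub_le_sup; last by exists (x, y).
  by exists M => _ [[u v] [Au Av] <-]; exact: rhoM.
apply/eqP; rewrite eq_le; apply/andP; split; apply: ge_sup.
- by exists (extension rho a a), (a, a).
- by move=> _ [[x y] _ <-] /=; exact: extension_le.
- by exists (rho a a), (a, a).
move=> _ [[x y] [/= Ax Ay] <-]; rewrite -extension_id //.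
apply: ub_le_sup; last by exists (x, y).
by exists (pm_norm rho) => _ [[u v] _ <-] /=; exact: extension_le.
Qed.

(** * Continuity of the operator for the Vietoris topology *)

Lemma near_extension_graph rho x y (O : set (X * X * R)) :
  open O -> O (x, y, extension rho x y) ->
  \forall p \near (x, y) & lam \near rho, O (p, extension lam p.1 p.2).
Proof.
move=> oO Oxy; have : nbhs (x, y, extension rho x y) O by exact: open_nbhs_nbhs.
move=> [[P V] /= [P_nbhs /nbhs_ballP[e /= e_gt0 eV]] PV].
have [del del_gt0 h] := cvg_extension rho x y e_gt0.
exists (P `&` [set p | d x p.1 < del /\ d y p.2 < del], near_pm del rho) => /=.
  split; last exact: near_pm_nbhs.
  apply: filterI => //.
  exists ([set x' | d x x' < del], [set y' | d y y' < del]) => //=.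
  by split; exact: ball_nbhs.
move=> [[x' y'] lam] /= [[Pp [xx' yy']] nlam]; apply: (PV (x', y', _)).
by split=> //=; apply: eV; rewrite -ball_normE /=; exact: h.
Qed.

(** Containment in the union is made uniform over all pairs by compactness of the square of [X].
    Each [U] in the list is met at a fixed pair [(x, y)], and there are finitely many of them. *)
Lemma near_vietoris_extension rho (Us : seq (set (X * X * R))) :
  vietoris_dom Us -> vietoris_base Us (pm_graph (pm_extension rho)) ->
  \forall lam \near rho, vietoris_base Us (pm_graph (pm_extension lam)).
Proof.
move=> oU [subU hitU].
have sub_near : \forall lam \near rho,
    (pm_graph (pm_extension lam) : set _) `<=` \bigcup_(U in [set` Us]) U.
  have /compact_near_coveringP XXc := compact_setX X_compact X_compact.
  have oO : open (\bigcup_(U in [set` Us]) U) by apply: bigcup_open => U /oU.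
  have : \forall lam \near rho, [set: X] `*` [set: X] `<=`
      (fun p => (\bigcup_(U in [set` Us]) U) (p, extension lam p.1 p.2)).
    apply: (XXc _ (nbhs rho) (fun lam p =>
      (\bigcup_(U in [set` Us]) U) (p, extension lam p.1 p.2))) => -[x y] _.
    by apply: near_extension_graph => //; apply: subU; exists (x, y).
  by apply: filterS => lam h _ [p _ <-]; exact: h.
have hit_near : \forall lam \near rho, forall U, U \in Us ->
    (pm_graph (pm_extension lam) : set _) `&` U !=set0.
  (* Generalizing one copy of [Us] to a sublist allows induction while [oU] and [hitU] still refer
     to the full list. *)
  have: {subset Us <= Us} by [].
  elim: {-2}Us => [|U Vs IH] sub; first by near=> lam => V; rewrite in_nil.
  have UUs : U \in Us by apply: sub; rewrite mem_head.
  have := IH (fun V VVs => sub V (@mem_behead _ (U :: Vs) V VVs)).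
  have [_ [[[x y] _ <-] Uxy]] := hitU U UUs.
  have [[P Q] /= [Pxy Qrho] PQ] := near_extension_graph (oU U UUs) Uxy.
  apply: filterS2 Qrho => lam Qlam Vs_hit V; rewrite inE => /predU1P[->|/Vs_hit//].
  exists (x, y, extension lam x y); split; first by exists (x, y).
  by apply: (PQ (x, y, lam)); split=> //; exact: nbhs_singleton Pxy.
by apply: filterS2 sub_near hit_near => lam.
Unshelve. all: by end_near. Qed.

Lemma continuous_pm_extension : continuous pm_extension.
Proof.
apply: (@continuous_comp_initial (PM R X) _ _ (@pm_graph R X)) => rho V.
move=> /vietoris_nbhs[Us [oU rhoU UV]].
by apply: filterS (near_vietoris_extension oU rhoU) => lam; exact: UV.
Qed.

End extension.

Theorem theorem4p6 (R : realType) (X : topologicalType)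
    (X_metrizable : metrizable R X)
    (X_compact : compact [set: X])
    (X_card : exists x y : X, x <> y) :
  exists u : PM R X -> PM_full R X,
    [/\ continuous u, regular_operator u, linear_operator u
      & extension_operator u].
Proof.
(* The point [x0] serves as the default entry of the nets. *)
have [d d_metric d_nbhs] := X_metrizable; have [x0 _] := X_card.
have [z [r [r_gt0 zr_dense]]] := compact_metric_basis x0 d_metric d_nbhs X_compact.
pose E := pm_extension d_metric d_nbhs X_compact r_gt0 zr_dense.
have E_full rho : E rho \in PM_full R X by rewrite inE.
exists (fun rho => SigSub (E_full rho)); split.
- apply: (@continuous_comp_initial (PM_full R X) _ _ set_val).
  exact: continuous_pm_extension.
- by move=> rho; exact: pm_norm_extension.
- split=> [c c0|] rho *; first exact: extension_scale.
  exact: extension_add.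
- by move=> rho x y; exact: extension_id.
Qed.
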